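(* For all $n\ge2$ and $P,Q\in\Gamma_n$, $$\mathcal W_s(P\Vert Q)\le\tfrac18\mathcal V_s(P\Vert Q)\quad\text{for }s\ge2\text{ or }s\le-1,\qquad \mathcal W_s(P\Vert Q)\ge\tfrac18\mathcal V_s(P\Vert Q)\quad\text{for }\tfrac12\le s\le1.$$
   Context: $\Gamma_n=\{P=(p_1,\dots,p_n): p_i>0,\ \sum_{i=1}^n p_i=1\}$. For $P,Q\in\Gamma_n$ and $s\in\mathbb{R}$, $$\mathcal V_s(P\Vert Q)=\begin{cases}[s(s-1)]^{-1}\left[\sum_{i=1}^n\left(p_i^sq_i^{1-s}+p_i^{1-s}q_i^s\right)-2\right], & s\ne0,1,\\ \sum_{i=1}^n(p_i-q_i)\ln\left(\frac{p_i}{q_i}\right), & s=0,1,\end{cases}$$ $$\mathcal W_s(P\Vert Q)=\begin{cases}[s(s-1)]^{-1}\left[\sum_{i=1}^n\left(\frac{p_i^{1-s}+q_i^{1-s}}{2}\right)\left(\frac{p_i+q_i}{2}\right)^s-1\right], & s\ne0,1,\\ \frac12\left[\sum_{i=1}^n p_i\ln\left(\frac{2p_i}{p_i+q_i}\right)+\sum_{i=1}^n q_i\ln\left(\frac{2q_i}{p_i+q_i}\right)\right], & s=0,\\ \sum_{i=1}^n\left(\frac{p_i+q_i}{2}\right)\ln\left(\frac{p_i+q_i}{2\sqrt{p_iq_i}}\right), & s=1.\end{cases}$$ *)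

(* Defs.v *)
From mathcomp Require Import all_boot all_order all_algebra.
From mathcomp Require Import all_classical all_reals all_analysis.

Set Implicit Arguments.
Unset Strict Implicit.
Unset Printing Implicit Defensive.

Import Order.TTheory GRing.Theory Num.Theory.

Local Open Scope classical_set_scope.
Local Open Scope ring_scope.

Definition Gamma (R : realType) (n : nat) : set ('I_n -> R) :=
  [set P | (forall i, 0 < P i) /\ \sum_(i < n) P i = 1].
Arguments Gamma : clear implicits.

Definition V_div (R : realType) (n : nat) (s : R) (P Q : 'I_n -> R) : R :=
  if (s == 0) || (s == 1) then
    \sum_(i < n) (P i - Q i) * ln (P i / Q i)
  else
    (s * (s - 1))^-1 *
    (\sum_(i < n) (P i `^ s * Q i `^ (1 - s) + P i `^ (1 - s) * Q i `^ s) - 2).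

Definition W_div (R : realType) (n : nat) (s : R) (P Q : 'I_n -> R) : R :=
  if s == 0 then
    2^-1 * (\sum_(i < n) P i * ln (2 * P i / (P i + Q i))
            + \sum_(i < n) Q i * ln (2 * Q i / (P i + Q i)))
  else if s == 1 then
    \sum_(i < n) (P i + Q i) / 2 *
      ln ((P i + Q i) / (2 * Num.sqrt (P i * Q i)))
  else
    (s * (s - 1))^-1 *
    (\sum_(i < n) (P i `^ (1 - s) + Q i `^ (1 - s)) / 2
                  * ((P i + Q i) / 2) `^ s - 1).

(* Main.v *)
Require Import Defs.
From mathcomp Require Import all_boot all_order all_algebra.
From mathcomp Require Import all_classical all_reals all_analysis.
From mathcomp Require Import ring lra.
Import Order.TTheory GRing.Theory Num.Theory.
Import numFieldNormedType.Exports.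
Local Open Scope ring_scope.

(** Both measures are Csiszar divergences: for s different from 0, each is a sum
of q_i f(p_i / q_i) with a generator f which, after an affine correction that
sums to zero over probability vectors, vanishes at 1 together with its
derivative ([V_div_sum], [W_div_sum]).  Comparing the divergences thus reduces
to comparing the second derivatives of the generators ([flat_at1_le]).  These
are given by one formula for all s, the logarithmic case s = 1 included:
  f_V''(x) = x^(s-2) + x^(-s-1),
  f_W''(x) = 1/8 ((x+1)/2)^(s-2) (1 + x^(-s-1))
([flat_v_gen], [flat_w_gen]).

Put F(a) = 1 + x^a and m = (x+1)/2.  After multiplication by a power of x, the
comparison of f_W'' with f_V''/8 becomes
  m^(s-2) F(s+1) against F(2s-1)              (s >= 2 and 1/2 <= s <= 1),
  m^(s-2) F(-s-1) against x^(s-2) F(1-2s)     (s <= -1).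
In each case the two exponents of F differ by |s-2|, and F(a+t)/F(a) increases
with a for fixed t >= 0 ([add1_powR_shift]); moving a down to 0 or 1 leaves the
convexity inequality m^p <= F(p)/2 for p >= 1 ([powR_midpoint]), combined for
s <= -1 with x <= m^2. *)

(** * Power inequalities *)

Lemma powRD_gt0 {R : realType} (x a b : R) : 0 < x ->
  x `^ (a + b) = x `^ a * x `^ b.
Proof. by move=> x0; rewrite powRD// (gt_eqF x0) implybT. Qed.

Lemma powR_midpoint {R : realType} (x p : R) : 0 < x -> 1 <= p ->
  ((x + 1) / 2) `^ p <= (1 + x `^ p) / 2.
Proof.
move=> x0 p1; have [h0 h1] : 0 <= (2^-1 : R) /\ (2^-1 : R) <= 1 by split; lra.
have := @convex_powR R p p1 (Itv01 h0 h1) x 1.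
rewrite !inE/= !in_itv/= !andbT => /(_ (ltW x0) ler01) conv_le.
rewrite convRE [X in X `^ _ <= _]convRE /= powR1 in conv_le.
move: conv_le.
have -> : unstable.onem 2^-1 = 2^-1 :> R by rewrite /unstable.onem; lra.
have -> : 2^-1 * x + 2^-1 * 1 = (x + 1) / 2 by field.
by have -> : 2^-1 * x `^ p + 2^-1 * 1 = (1 + x `^ p) / 2 by field.
Qed.

(** The difference of the two sides is x^a (x^(b-a) - 1) (x^t - 1), whose last
two factors have the same sign because both exponents are nonnegative. *)
Lemma add1_powR_shift {R : realType} (x a b t : R) : 0 < x -> a <= b -> 0 <= t ->
  (1 + x `^ (a + t)) * (1 + x `^ b) <= (1 + x `^ a) * (1 + x `^ (b + t)).
Proof.
move=> x0 ab t0.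
rewrite -subr_ge0 in ab.
have -> : b = a + (b - a) by ring.
move: (b - a) ab => d d0; rewrite !powRD_gt0//.
set u := x `^ a; set w := x `^ d; set k := x `^ t.
have u0 : 0 < u by exact: powR_gt0.
rewrite -subr_ge0.
have -> : (1 + u) * (1 + u * w * k) - (1 + u * k) * (1 + u * w) =
  u * ((w - 1) * (k - 1)) by ring.
rewrite mulr_ge0 ?(ltW u0)//.
have [x1|x1] := leP 1 x.
  by rewrite mulr_ge0// subr_ge0 -(powRr0 x) ler_powR.
have x01 : 0 < x <= 1 by rewrite x0 ltW.
by rewrite mulr_le0// subr_le0 -(powRr0 x) ger_powR.
Qed.

(** * Comparison of the second derivatives *)

Definition v_deriv2 {R : realType} (s x : R) := x `^ (s - 2) + x `^ (- s - 1).

Definition w_deriv2 {R : realType} (s x : R) :=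
  8^-1 * (((x + 1) / 2) `^ (s - 2) * (1 + x `^ (- s - 1))).

(** When s - 2 < 1, the power m^(s-2) is concave in m and cannot be bounded by
convexity, so the shift goes down to a = 1: since F(1) = 2m, the spare factor m
turns the power into m^(s-1), whose exponent is at least 1. *)
Lemma w_deriv2_le_ge2 {R : realType} (s x : R) : 0 < x -> 2 <= s ->
  w_deriv2 s x <= 8^-1 * v_deriv2 s x.
Proof.
move=> x0 s2; rewrite /w_deriv2 /v_deriv2 ler_pM2l ?invr_gt0//.
set m := (x + 1) / 2; have m0 : 0 < m by rewrite /m; lra.
have sh := add1_powR_shift x 1 (s + 1) (s - 2) x0 ltac:(lra) ltac:(lra).
have mid := powR_midpoint x (1 + (s - 2)) x0 ltac:(lra).
have key : m `^ (s - 2) * (1 + x `^ (s + 1)) <= 1 + x `^ (s + 1 + (s - 2)).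
  rewrite -(ler_pM2l m0).
  move: mid; rewrite -/m (powRD_gt0 m 1 _ m0) powRr1 ?(ltW m0)// => mid.
  rewrite mulrA.
  apply: (@le_trans _ _ ((1 + x `^ (1 + (s - 2))) / 2 * (1 + x `^ (s + 1)))).
    by rewrite ler_pM2r// ltr_wpDr ?powR_ge0.
  by move: sh; rewrite powRr1 ?(ltW x0)// /m; lra.
rewrite -(ler_pM2l (powR_gt0 (- s - 1) x0)) in key.
have e0 : x `^ (- s - 1) * x `^ (s + 1) = 1.
  by rewrite -powRD_gt0// -[RHS](powRr0 x); congr powR; ring.
have e1 : x `^ (- s - 1) * x `^ (s + 1 + (s - 2)) = x `^ (s - 2).
  by rewrite -powRD_gt0//; congr powR; ring.
have e2 : m `^ (s - 2) * (x `^ (- s - 1) * x `^ (s + 1)) = m `^ (s - 2).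
  by rewrite e0 mulr1.
lra.
Qed.

(** The shift to a = 0 controls m^(2-s), while the inequality involves m^(s-2);
the arithmetic-geometric inequality x <= m^2 passes from one to the other. *)
Lemma w_deriv2_le_leN1 {R : realType} (s x : R) : 0 < x -> s <= -1 ->
  w_deriv2 s x <= 8^-1 * v_deriv2 s x.
Proof.
move=> x0 s1; rewrite /w_deriv2 /v_deriv2 ler_pM2l ?invr_gt0//.
set m := (x + 1) / 2; have m0 : 0 < m by rewrite /m; lra.
have sh := add1_powR_shift x 0 (- s - 1) (2 - s) x0 ltac:(lra) ltac:(lra).
have mid := powR_midpoint x (2 - s) x0 ltac:(lra).
have key : m `^ (2 - s) * (1 + x `^ (- s - 1)) <= 1 + x `^ (- s - 1 + (2 - s)).
  apply: (@le_trans _ _ ((1 + x `^ (2 - s)) / 2 * (1 + x `^ (- s - 1)))).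
    by rewrite ler_pM2r// ltr_wpDr ?powR_ge0.
  by move: sh; rewrite powRr0 add0r; lra.
(* Equivalent to x^(2-s) <= m^(2 (2-s)). *)
have amgm : m `^ (s - 2) <= x `^ (s - 2) * m `^ (2 - s).
  have E y : y `^ (s - 2) = (y `^ (2 - s))^-1 by rewrite -powRN opprB.
  rewrite !E mulrC ler_pdivlMr ?powR_gt0// mulrC ler_pdivrMr ?powR_gt0//.
  rewrite -powRM ?(ltW m0)//.
  apply: ge0_ler_powR; first lra.
  - by rewrite nnegrE ltW.
  - by rewrite nnegrE ltW// mulr_gt0.
  - by have := sqr_ge0 (x - 1); rewrite /m; nra.
apply: (@le_trans _ _ (x `^ (s - 2) * m `^ (2 - s) * (1 + x `^ (- s - 1)))).
  by rewrite ler_pM2r// ltr_wpDr ?powR_ge0.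
rewrite -(ler_pM2l (powR_gt0 (s - 2) x0)) in key.
rewrite -mulrA; apply: (le_trans key).
rewrite mulrDr mulr1 -powRD_gt0//.
by have -> : s - 2 + (- s - 1 + (2 - s)) = - s - 1 by ring.
Qed.

(** Here 2s - 1 >= 0 allows the shift to a = 0, and 2 - s >= 1 the use of
convexity. *)
Lemma w_deriv2_ge {R : realType} (s x : R) : 0 < x -> 2^-1 <= s <= 1 ->
  8^-1 * v_deriv2 s x <= w_deriv2 s x.
Proof.
move=> x0 /andP[s2 s1]; rewrite /w_deriv2 /v_deriv2 ler_pM2l ?invr_gt0//.
set m := (x + 1) / 2; have m0 : 0 < m by rewrite /m; lra.
have sh := add1_powR_shift x 0 (2 * s - 1) (2 - s) x0 ltac:(lra) ltac:(lra).
have mid := powR_midpoint x (2 - s) x0 ltac:(lra).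
have key : m `^ (2 - s) * (1 + x `^ (2 * s - 1)) <=
    1 + x `^ (2 * s - 1 + (2 - s)).
  apply: (@le_trans _ _ ((1 + x `^ (2 - s)) / 2 * (1 + x `^ (2 * s - 1)))).
    by rewrite ler_pM2r// ltr_wpDr ?powR_ge0.
  by move: sh; rewrite powRr0 add0r; lra.
have -> : m `^ (s - 2) = (m `^ (2 - s))^-1 by rewrite -powRN opprB.
rewrite mulrC ler_pdivlMr ?powR_gt0//.
rewrite -(ler_pM2l (powR_gt0 (- s - 1) x0)) in key.
have e0 : x `^ (- s - 1) * x `^ (2 * s - 1) = x `^ (s - 2).
  by rewrite -powRD_gt0//; congr powR; ring.
have e1 : x `^ (- s - 1) * x `^ (2 * s - 1 + (2 - s)) = 1.
  by rewrite -powRD_gt0// -[RHS](powRr0 x); congr powR; ring.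
rewrite -e0; lra.
Qed.

(** * Comparison principle *)

(** Normalization at 1 under which functions on the positive half-line are ordered
as soon as their second derivatives [f2] are. *)
Definition flat_at1 {R : realType} (f f2 : R -> R) := exists f1 : R -> R,
  [/\ forall x : R, 0 < x -> is_derive x 1 f (f1 x),
      forall x : R, 0 < x -> is_derive x 1 f1 (f2 x), f 1 = 0 & f1 1 = 0].

(** The sign condition on [c] records that it lies on the same side of 1 as
[x], so that the two cases x < 1 and x > 1 need not be separated again. *)
Lemma MVT_from1 {R : realType} (f f1 : R -> R) (x : R) :
  (forall y : R, 0 < y -> is_derive y 1 f (f1 y)) -> f 1 = 0 -> 0 < x ->
  exists c : R, [/\ 0 < c, 0 <= (c - 1) * (x - 1) & f x = f1 c * (x - 1)].
Proof.
move=> df f10 x0.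
have cf (a b : R) : 0 < a -> ({within `[a, b], continuous f})%classic.
  move=> a0; apply: derivable_within_continuous => y.
  rewrite in_itv/= => /andP[ay _].
  by apply: ex_derive; apply: df; exact: lt_le_trans ay.
have [x1|x1] := leP x 1.
  have [y||c] := @MVT_segment _ f f1 x 1 x1.
  - by rewrite in_itv/= => /andP[xy _]; apply: df; exact: lt_trans xy.
  - exact: cf.
  - rewrite in_itv/= f10 => /andP[xc c1] E; exists c; split; [lra|nra|lra].
have [y||c] := @MVT_segment _ f f1 1 x (ltW x1).
- by rewrite in_itv/= => /andP[xy _]; apply: df; exact: lt_trans xy.
- exact: cf.
- rewrite in_itv/= f10 => /andP[xc c1] E; exists c; split; [lra|nra|lra].
Qed.

(** With h = g - f, two applications of the mean value theorem give
h(x) = h''(d) (c - 1) (x - 1), where c lies between 1 and x. *)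
Lemma flat_at1_le {R : realType} (f g f2 g2 : R -> R) :
  flat_at1 f f2 -> flat_at1 g g2 -> (forall x : R, 0 < x -> f2 x <= g2 x) ->
  forall x : R, 0 < x -> f x <= g x.
Proof.
move=> [f1 [df df1 f0 f10]] [g1 [dg dg1 g0 g10]] le2 x x0.
have [||//|c [c0 xc]] := @MVT_from1 _ (g - f) (g1 - f1) x.
- by move=> y y0; apply: is_deriveB; [exact: dg|exact: df].
- by rewrite !fctE f0 g0 subr0.
have [||//|d [d0 _]] := @MVT_from1 _ (g1 - f1) (fun y => g2 y - f2 y) c.
- by move=> y y0; apply: is_deriveB; [exact: dg1|exact: df1].
- by rewrite !fctE f10 g10 subr0.
rewrite -(subr_ge0 (f x)) !fctE => -> ->.
by rewrite -mulrA mulr_ge0// subr_ge0 le2.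
Qed.

Lemma flat_at1_scale {R : realType} (k : R) (f f2 : R -> R) :
  flat_at1 f f2 -> flat_at1 (fun x => k * f x) (fun x => k * f2 x).
Proof.
move=> [f1 [df df1 f0 f10]]; exists (fun x => k * f1 x).
split; rewrite ?f0 ?f10 ?mulr0// => x x0.
- by apply: is_deriveZ; exact: df.
- by apply: is_deriveZ; exact: df1.
Qed.

(** * The generators *)

(** For s <> 1 the subtracted terms 1 + x, and (x + 1) / 2 in [w_gen], are the affine corrections that
make the generators vanish to first order at 1; weighted by q_i at
x = p_i / q_i, they sum to the constants 2 and 1 of the two measures. *)
Definition v_gen {R : realType} (s x : R) :=
  if s == 1 then (x - 1) * ln x
  else (s * (s - 1))^-1 * (x `^ s + x `^ (1 - s) - (1 + x)).

Definition w_gen {R : realType} (s x : R) :=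
  if s == 1 then (x + 1) / 2 * (ln ((x + 1) / 2) - ln x / 2)
  else (s * (s - 1))^-1 *
    ((x `^ (1 - s) + 1) / 2 * ((x + 1) / 2) `^ s - (x + 1) / 2).

Lemma is_derive_powR_mid {R : realType} (a x : R) : 0 < x ->
  is_derive x 1 (fun y : R => ((y + 1) / 2) `^ a)
    (a / 2 * ((x + 1) / 2) `^ (a - 1)).
Proof.
move=> x0.
have m0 : 0 < (x + 1) / 2 by lra.
have dm : is_derive x 1 (fun y : R => (y + 1) / 2) (2^-1).
  by apply: is_derive_eq; rewrite /GRing.scale/=; lra.
have dp := is_derive1_powR a m0.
have -> : a / 2 * ((x + 1) / 2) `^ (a - 1) =
    a * ((x + 1) / 2) `^ (a - 1) * 2^-1 by ring.
have dc := @is_derive1_comp R (@powR R ^~ a) (fun y => (y + 1) / 2) x _ _ dp dm.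
exact: dc.
Qed.

Lemma flat_v_gen {R : realType} (s : R) : s != 0 ->
  flat_at1 (v_gen s) (v_deriv2 s).
Proof.
move=> s0; rewrite /v_gen /v_deriv2; have [->|s1] := eqVneq s 1.
  exists (fun x => ln x + (x - 1) / x); split => [x x0|x x0||].
  - have dl := is_derive1_ln x0.
    by apply: is_derive_eq; rewrite /GRing.scale/=; ring.
  - have dl := is_derive1_ln x0.
    have dv : is_derive x 1 (fun y : R => y^-1) (- x ^- 2).
      have := @is_deriveV _ id x 1 1; rewrite /GRing.scale/= mulr1; apply.
      by rewrite gt_eqF.
    apply: is_derive_eq; rewrite /GRing.scale/=.
    have -> : 1 - 2 = -1 :> R by ring.
    have -> : - 1 - 1 = - 2%:R :> R by ring.
    rewrite powR_inv1 ?(ltW x0)// powR_invn ?(ltW x0)//.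
    by field; rewrite gt_eqF.
  - by rewrite subrr mul0r.
  - by rewrite subrr mul0r ln1 addr0.
have ss : s - 1 != 0 by rewrite subr_eq0.
exists (fun x => (s * (s - 1))^-1 *
  (s * x `^ (s - 1) + (1 - s) * x `^ (- s) - 1)); split => [x x0|x x0||].
- have d1 := is_derive1_powR s x0.
  have d2 := is_derive1_powR (1 - s) x0.
  have e : 1 - s - 1 = - s by ring.
  rewrite e in d2.
  by apply: is_derive_eq; rewrite /GRing.scale/=; ring.
- have d1 := is_derive1_powR (s - 1) x0.
  have d2 := is_derive1_powR (- s) x0.
  have e : s - 1 - 1 = s - 2 by ring.
  rewrite e in d1.
  by apply: is_derive_eq; rewrite /GRing.scale/=; field; rewrite ss s0.
- by rewrite !powR1; ring.
- by rewrite !powR1; ring.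
Qed.

Lemma flat_w_gen {R : realType} (s : R) : s != 0 ->
  flat_at1 (w_gen s) (w_deriv2 s).
Proof.
have mid1 : (1 + 1) / 2 = 1 :> R by field.
move=> s0; rewrite /w_gen /w_deriv2; have [->|s1] := eqVneq s 1.
  exists (fun x =>
    2^-1 * (ln ((x + 1) / 2) - ln x / 2) + 2^-1 - (x + 1) / (4 * x)).
  have dm (x : R) : 0 < x ->
      is_derive x 1 (fun y : R => ln ((y + 1) / 2)) ((x + 1)^-1).
    move=> x0; have m0 : 0 < (x + 1) / 2 by lra.
    have dm : is_derive x 1 (fun y : R => (y + 1) / 2) (2^-1).
      by apply: is_derive_eq; rewrite /GRing.scale/=; lra.
    have dl := is_derive1_ln m0.
    have dc := @is_derive1_comp R (@ln R) (fun y => (y + 1) / 2) x _ _ dl dm.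
    have -> : (x + 1)^-1 = ((x + 1) / 2)^-1 * 2^-1 by field; lra.
    exact: dc.
  split => [x x0|x x0||].
  - have d1 := dm x x0; have dl := is_derive1_ln x0.
    apply: is_derive_eq; rewrite /GRing.scale/=.
    by field; lra.
  - have d1 := dm x x0; have dl := is_derive1_ln x0.
    have dv : is_derive x 1 (fun y : R => (4 * y)^-1) (- (4 * x) ^- 2 * 4).
      have d4 : is_derive x 1 (fun y : R => 4 * y) 4.
        by apply: is_derive_eq; rewrite /GRing.scale/=; ring.
      have n4 : 4 * x != 0 by lra.
      exact: (@is_deriveV _ (fun y => 4 * y) x 4 1 n4 d4).
    apply: is_derive_eq; rewrite /GRing.scale/=.
    have -> : 1 - 2 = -1 :> R by ring.
    have -> : - 1 - 1 = - 2%:R :> R by ring.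
    rewrite powR_inv1 ?powR_invn ?(ltW x0)//; last by lra.
    by field; lra.
  - by rewrite mid1 ln1; ring.
  - by rewrite mid1 ln1; field.
have ss : s - 1 != 0 by rewrite subr_eq0.
exists (fun x => (s * (s - 1))^-1 *
  ((1 - s) * x `^ (- s) / 2 * ((x + 1) / 2) `^ s +
   (x `^ (1 - s) + 1) / 2 * (s / 2 * ((x + 1) / 2) `^ (s - 1)) - 2^-1));
  split => [x x0|x x0||].
- have d1 := is_derive_powR_mid s x x0.
  have d2 := is_derive1_powR (1 - s) x0.
  have e : 1 - s - 1 = - s by ring.
  rewrite e in d2.
  by apply: is_derive_eq; rewrite /GRing.scale/=; ring.
- have d1 := is_derive_powR_mid s x x0.
  have d2 := is_derive_powR_mid (s - 1) x x0.
  have d3 := is_derive1_powR (1 - s) x0.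
  have d4 := is_derive1_powR (- s) x0.
  apply: is_derive_eq; rewrite /GRing.scale/=.
  set m := (x + 1) / 2; have m0 : 0 < m by rewrite /m; lra.
  have -> : s - 1 - 1 = s - 2 by ring.
  have -> : 1 - s - 1 = - s by ring.
  have xE : x `^ (- s) = x `^ (- s - 1) * x.
    by rewrite -{3}(powRr1 (ltW x0)) -powRD_gt0// subrK.
  have xE1 : x `^ (1 - s) = x `^ (- s - 1) * x * x.
    by rewrite -xE -{3}(powRr1 (ltW x0)) -powRD_gt0// addrC.
  have mE : m `^ (s - 1) = m `^ (s - 2) * m.
    rewrite -{3}(powRr1 (ltW m0)) -powRD_gt0//; congr powR; ring.
  have mE1 : m `^ s = m `^ (s - 2) * m * m.
    rewrite -mE -{3}(powRr1 (ltW m0)) -powRD_gt0//; congr powR; ring.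
  rewrite xE1 xE mE1 mE /m.
  by field; rewrite ss s0.
- by rewrite mid1 !powR1 mid1; ring.
- by rewrite mid1 !powR1 mid1; field; rewrite ss s0.
Qed.

(** * The divergences as sums over their generators *)

Lemma V_div_sum {R : realType} (n : nat) (s : R) (P Q : 'I_n -> R) :
  Gamma R n P -> Gamma R n Q -> s != 0 ->
  V_div s P Q = \sum_(i < n) Q i * v_gen s (P i / Q i).
Proof.
move=> [P0 P1] [Q0 Q1] s0; rewrite /V_div /v_gen (negbTE s0) /=.
case: eqVneq => [_|s1].
  apply: eq_bigr => i _; have q0 := Q0 i.
  by field; lra.
have -> : 2 = \sum_(i < n) (P i + Q i) by rewrite big_split/= P1 Q1.
rewrite -sumrB big_distrr/=; apply: eq_bigr => i _.
have p0 := P0 i; have q0 := Q0 i.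
have pE a : (P i / Q i) `^ a = P i `^ a * (Q i `^ a)^-1.
  rewrite powRM ?(ltW p0) ?invr_ge0 ?(ltW q0)//.
  by rewrite -powR_inv1 ?(ltW q0)// powRAC powR_inv1// powR_ge0.
have qE : Q i = Q i `^ s * Q i `^ (1 - s).
  by rewrite -powRD_gt0// subrKC powRr1 ?(ltW q0).
rewrite !pE.
have := powR_gt0 s q0; have := powR_gt0 (1 - s) q0.
move: (Q i `^ s) (Q i `^ (1 - s)) qE => u v qE v0 u0.
by rewrite qE; field; rewrite (gt_eqF u0) (gt_eqF v0) subr_eq0 s1 s0.
Qed.

Lemma W_div_sum {R : realType} (n : nat) (s : R) (P Q : 'I_n -> R) :
  Gamma R n P -> Gamma R n Q -> s != 0 ->
  W_div s P Q = \sum_(i < n) Q i * w_gen s (P i / Q i).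
Proof.
move=> [P0 P1] [Q0 Q1] s0; rewrite /W_div /w_gen (negbTE s0) /=.
case: eqVneq => [_|s1].
  apply: eq_bigr => i _; have p0 := P0 i; have q0 := Q0 i.
  have x0 : 0 < P i / Q i by rewrite divr_gt0.
  have m0 : 0 < (P i / Q i + 1) / 2 by lra.
  (* The factor Q i cancels, since sqrt (P i * Q i) = Q i * sqrt (P i / Q i). *)
  have -> : (P i + Q i) / (2 * Num.sqrt (P i * Q i)) =
      (P i / Q i + 1) / 2 / (P i / Q i) `^ 2^-1.
    rewrite powR12_sqrt ?(ltW x0)//.
    have -> : P i * Q i = P i / Q i * Q i ^+ 2 by field; lra.
    rewrite sqrtrM ?(ltW x0)// sqrtr_sqr gtr0_norm//.
    have r0 : 0 < Num.sqrt (P i / Q i) by rewrite sqrtr_gt0.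
    by field; rewrite !gt_eqF.
  rewrite ln_div ?posrE ?powR_gt0// ln_powR.
  by field; lra.
have sum1 : 1 = \sum_(i < n) (P i + Q i) / 2 :> R.
  by rewrite -mulr_suml big_split/= P1 Q1; field.
rewrite [X in _^-1 * (_ - X)]sum1.
rewrite -sumrB big_distrr/=; apply: eq_bigr => i _.
have p0 := P0 i; have q0 := Q0 i.
have x0 : 0 < P i / Q i by rewrite divr_gt0.
have mE : (P i + Q i) / 2 = (P i / Q i + 1) / 2 * Q i by field; lra.
have pE : P i `^ (1 - s) = (P i / Q i) `^ (1 - s) * Q i `^ (1 - s).
  by rewrite -powRM ?(ltW x0) ?(ltW q0)// divfK// gt_eqF.
have qE : Q i `^ s * Q i `^ (1 - s) = Q i.
  by rewrite -powRD_gt0// subrKC powRr1 ?(ltW q0).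
have m0 : 0 <= (P i / Q i + 1) / 2 by lra.
rewrite pE mE (powRM _ m0 (ltW q0)).
transitivity ((s * (s - 1))^-1 *
  (((P i / Q i) `^ (1 - s) + 1) / 2 * ((P i / Q i + 1) / 2) `^ s *
     (Q i `^ s * Q i `^ (1 - s)) - (P i / Q i + 1) / 2 * Q i)); first by ring.
by rewrite qE; ring.
Qed.

(** * The inequalities *)

Theorem mainTheorem14 (R : realType) (n : nat) (hn : (2 <= n)%N)
    (P Q : 'I_n -> R) (hP : Gamma R n P) (hQ : Gamma R n Q) :
  (forall s : R, 2 <= s \/ s <= -1 -> W_div s P Q <= 8^-1 * V_div s P Q) /\
  (forall s : R, 2^-1 <= s <= 1 -> 8^-1 * V_div s P Q <= W_div s P Q).
Proof.
have ratio_gt0 i : 0 < P i / Q i by rewrite divr_gt0// (hP.1, hQ.1).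
split=> [s hs|s /[dup] hs /andP[s_ge s_le]].
- have s0 : s != 0 by case: hs => ?; lra.
  have le2 (x : R) : 0 < x -> w_deriv2 s x <= 8^-1 * v_deriv2 s x.
    by case: hs => hs x0; [exact: w_deriv2_le_ge2|exact: w_deriv2_le_leN1].
  rewrite V_div_sum// W_div_sum// big_distrr/=; apply: ler_sum => i _.
  rewrite mulrCA ler_pM2l ?hQ.1//.
  exact (flat_at1_le _ _ _ _ (flat_w_gen s s0)
    (flat_at1_scale 8^-1 _ _ (flat_v_gen s s0)) le2 _ (ratio_gt0 i)).
- have s0 : s != 0 by lra.
  have le2 (x : R) : 0 < x -> 8^-1 * v_deriv2 s x <= w_deriv2 s x.
    by move=> x0; exact: w_deriv2_ge.
  rewrite V_div_sum// W_div_sum// big_distrr/=; apply: ler_sum => i _.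
  rewrite mulrCA ler_pM2l ?hQ.1//.
  exact (flat_at1_le _ _ _ _ (flat_at1_scale 8^-1 _ _ (flat_v_gen s s0))
    (flat_w_gen s s0) le2 _ (ratio_gt0 i)).
Qed.
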